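(* Let $A,B$ be finite graphs and let $i:A\to B$ be an induced subgraph inclusion that is a $\times$-homotopy equivalence, with $|V(A)|<|V(B)|$. If $B$ does not fold to $A$ via some sequence of relative folds with respect to $A$, then there exist a finite graph $C$ and a graph map $f:A\to C$ such that the cobase change of $i$ along $f$ is not a $\times$-homotopy equivalence.
   Context: A graph $G$ is a pair $(V(G),E(G))$ where $E(G)$ is a set of unordered pairs $\{x,y\}$ (written $xy$) of vertices, with $x=y$ allowed (a loop); there are no multiple edges. All graphs are finite. A graph map $f:G\to H$ is a function $V(G)\to V(H)$ such that $xy\in E(G)$ implies $f(x)f(y)\in E(H)$. $\mathcal{G}$ is the category of finite graphs and graph maps. An induced subgraph inclusion is the inclusion $i:A\to B$ of a subgraph $A$ of $B$ such that $ab\in E(B)$ with $a,b\in V(A)$ implies $ab\in E(A)$. The product $G\times H$ has vertex set $V(G)\times V(H)$, and $(g,h)(g',h')\in E(G\times H)$ iff $gg'\in E(G)$ and $hh'\in E(H)$. For $n\in\mathbb{N}$, $I_n$ is the graph with vertex set $\{0,1,\dots,n\}$ and edges $ij$ for $|i-j|\le 1$. Two graph maps $f,g:A\to B$ are $\times$-homotopic, $f\simeq_\times g$, if for some $n\in\mathbb{N}$ there is a graph map $F:A\times I_n\to B$ with $F(a,0)=f(a)$ and $F(a,n)=g(a)$ for all $a\in V(A)$. A graph map $f:A\to B$ is a $\times$-homotopy equivalence if there is a graph map $g:B\to A$ with $gf\simeq_\times 1_A$ and $fg\simeq_\times 1_B$. For a vertex $v$ of $G$, $N_G(v)=\{x\in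 V(G): vx\in E(G)\}$. A vertex $v$ of $G$ folds to a vertex $v'\ne v$ of $G$ if $N_G(v)\subseteq N_G(v')$; then the fold map $G\to G-v$ (where $G-v$ is the induced subgraph on $V(G)\setminus\{v\}$) is the graph map sending $v$ to $v'$ and fixing all other vertices. If $A$ is a subgraph of $B$, a fold map $B\to B-v$ is a relative fold in $B$ with respect to $A$ if $A$ is a subgraph of $B-v$. ''$B$ folds to $A$ via a sequence of relative folds'' means that there is a finite sequence of graphs $B=B_0,B_1,\dots,B_k=A$ with $B_{j+1}=B_j-v_j$ obtained from $B_j$ by a relative fold in $B_j$ with respect to $A$. The cobase change of $i:A\to B$ along $f:A\to C$ is the canonical map $C\to G$, where $G$ is the pushout of $B\xleftarrow{\,i\,}A\xrightarrow{\,f\,}C$ in $\mathcal{G}$. *)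

(* Defs.v *)
From mathcomp Require Import all_boot.

Set Implicit Arguments.
Unset Strict Implicit.
Unset Printing Implicit Defensive.

(* Loops are allowed: [edge] is not required to be irreflexive. *)
Record graph := Graph {
  vertex :> finType;
  edge : rel vertex;
  edge_sym : symmetric edge
}.

Record hom (G H : graph) := Hom {
  hom_fun :> G -> H;
  hom_edge : forall x y : G, edge x y -> edge (hom_fun x) (hom_fun y)
}.

Definition hom_id (G : graph) : hom G G :=
  @Hom G G (fun x => x) (fun x y xy => xy).

Definition hom_comp (G H K : graph) (g : hom H K) (f : hom G H) : hom G K :=
  @Hom G K (fun x => g (f x)) (fun x y xy => hom_edge g (hom_edge f xy)).

Definition prod_edge (G H : graph) : rel (G * H)%type :=
  fun p q => edge p.1 q.1 && edge p.2 q.2.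

Lemma prod_edge_sym (G H : graph) : symmetric (@prod_edge G H).
Proof. by move=> p q; rewrite /prod_edge edge_sym [edge p.2 _]edge_sym. Qed.

Definition gprod (G H : graph) : graph := Graph (@prod_edge_sym G H).

(* |i - j| <= 1, without truncated subtraction *)
Definition I_edge (n : nat) : rel 'I_n.+1 :=
  fun i j => (i <= j.+1) && (j <= i.+1).

Lemma I_edge_sym (n : nat) : symmetric (@I_edge n).
Proof. by move=> i j; rewrite /I_edge andbC. Qed.

Definition I_graph (n : nat) : graph := Graph (@I_edge_sym n).

Definition homotopic (A B : graph) (f g : hom A B) : Prop :=
  exists (n : nat) (F : hom (gprod A (I_graph n)) B),
    forall a : A, F (a, ord0) = f a /\ F (a, ord_max) = g a.

Definition homotopy_equivalence (A B : graph) (f : hom A B) : Prop :=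
  exists g : hom B A,
    homotopic (hom_comp g f) (hom_id A) /\ homotopic (hom_comp f g) (hom_id B).

(* A subgraph A of B is given by its inclusion, i.e. up to renaming the
   vertices of A; the second clause says that it is induced. *)
Definition induced_inclusion (A B : graph) (i : hom A B) : Prop :=
  injective i /\ (forall a b : A, edge (i a) (i b) -> edge a b).

Definition induced_edge (G : graph) (S : {set G}) : rel {x : G | x \in S} :=
  fun x y => edge (val x) (val y).

Lemma induced_edge_sym (G : graph) (S : {set G}) :
  symmetric (@induced_edge G S).
Proof. by move=> x y; rewrite /induced_edge edge_sym. Qed.

Definition induced (G : graph) (S : {set G}) : graph :=
  Graph (@induced_edge_sym G S).

Definition nbhd (G : graph) (v : G) : {set G} := [set x | edge v x].

Definition folds (G : graph) (v v' : G) : bool :=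
  (v' != v) && (nbhd v \subset nbhd v').

(* The graphs occurring in a sequence of folds starting from B are induced
   subgraphs of B, hence represented by their vertex sets.  [rel_fold A S T]:
   the graph on T is (graph on S) - v for some v folding to some v' in the
   graph on S, and still contains the subgraph with vertex set A. *)
Definition rel_fold (B : graph) (A : {set B}) : rel {set B} :=
  fun S T =>
    [exists v : induced S, exists v' : induced S,
       [&& folds v v', T == S :\ val v & A \subset T]].

Definition folds_to (B : graph) (A : {set B}) : Prop :=
  exists s : seq {set B}, path (rel_fold A) [set: B] s /\ last [set: B] s = A.

(* Graph maps are compared as functions on vertices (=1), so that the proof
   component of [hom] plays no role. *)
Definition is_pushout (A B C G : graph) (i : hom A B) (f : hom A C)
    (k : hom B G) (j : hom C G) : Prop :=
  hom_comp k i =1 hom_comp j f /\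
  forall (H : graph) (p : hom B H) (q : hom C H),
    hom_comp p i =1 hom_comp q f ->
    exists u : hom G H,
      [/\ hom_comp u k =1 p,
          hom_comp u j =1 q
        & forall u' : hom G H,
            hom_comp u' k =1 p -> hom_comp u' j =1 q -> u' =1 u].

Definition is_cobase_change (A B C G : graph) (i : hom A B) (f : hom A C)
    (j : hom C G) : Prop :=
  exists k : hom B G, is_pushout i f k j.

(* Main.v *)
(** Fold [B] relative to [A] as long as possible; this stops at a set [S] that
    strictly contains [A], is a retract of [B], and in which no vertex outside
    [A] folds.  Let [C] be [A] with a 5-cycle attached at each vertex, so that
    the pushout [G] is [B] with these cycles attached.  The cycles prevent the
    vertices of [C] from folding, hence [S] with the cycles is a stiff retract
    of [G].  On a stiff retract, any map homotopic to the identity of [G] is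
    the identity up to the retraction; but a map factoring through [C] misses
    the vertices of [S] outside [A]. *)

Require Import Defs.
From mathcomp Require Import all_boot.


Set Implicit Arguments.
Unset Strict Implicit.
Unset Printing Implicit Defensive.

(* Running the homotopy backwards from the identity, each step sends [x] to a
   vertex adjacent to all the neighbours of [x] in [T]. *)
Lemma homotopic_id_rigid (X : graph) (R phi : hom X X) (T : {set X}) :
    homotopic phi (hom_id X) ->
    {in T, forall x, R x = x} ->
    {in T, forall x y, {in T, forall z, edge x z -> edge (R y) z} -> R y = x} ->
  {in T, forall x, R (phi x) = x}.
Proof.
move=> [n [F F_ends]] fixR rigidR x0 Tx0.
have stay k : k <= n -> {in T, forall x, R (F (x, inord (n - k))) = x}.
  elim: k => [_|k IHk lt_kn] x Tx.
    have -> : inord (n - 0) = ord_max :> 'I_n.+1.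
      by apply: val_inj; rewrite /= inordK subn0.
    by rewrite (F_ends x).2 fixR.
  apply: rigidR => // z Tz xz.
  rewrite -[z in edge _ z](IHk (ltnW lt_kn)) //; apply/hom_edge/hom_edge.
  rewrite /= /prod_edge /= xz /I_edge !inordK ?ltnS ?leq_subr //.
  by rewrite -(subnSK lt_kn) leqnn !leqW.
have /(_ x0 Tx0) := stay n (leqnn n).
have -> : inord (n - n) = ord0 :> 'I_n.+1.
  by apply: val_inj; rewrite /= inordK subnn.
by rewrite (F_ends x0).1.
Qed.

Definition retraction_onto (B : graph) (S : {set B}) (r : hom B B) : Prop :=
  (forall x, r x \in S) /\ {in S, forall x, r x = x}.

(** Follow [r] by the fold map sending [v] to [v']. *)
Lemma rel_fold_retraction (B : graph) (A S T : {set B}) (r : hom B B) :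
    rel_fold A S T -> retraction_onto S r ->
  exists r' : hom B B, retraction_onto T r'.
Proof.
case/existsP=> -[v Sv] /existsP[[v' Sv']] /and3P[/andP[nev sub_v] /eqP-> _].
move: nev; rewrite -val_eqE /= => nev [rS fixr].
have v'_adj z : z \in S -> edge v z -> edge v' z.
  by move=> Sz vz; have /subsetP/(_ (exist _ z Sz)) := sub_v; rewrite !inE; apply.
have fold_edge x y :
    edge x y -> edge (if r x == v then v' else r x) (if r y == v then v' else r y).
  move/(hom_edge r); have := rS x; have := rS y.
  move: (r x) (r y) => p q Sq Sp pq.
  case: (eqVneq p v) (eqVneq q v) pq => [->|_] [->|_] // pq.
  (* Here [v] has a loop: it makes [v'] adjacent to [v], hence [v] to [v'], hence [v'] to itself. *)
  - by apply: (v'_adj) => //; rewrite edge_sym; apply: v'_adj.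
  - exact: v'_adj.
  - by rewrite edge_sym; apply: v'_adj => //; rewrite edge_sym.
exists (@Hom B B (fun x => if r x == v then v' else r x) fold_edge).
split=> x /=; first by case: eqVneq => [_|nerx]; rewrite !inE ?nev ?nerx ?rS.
by case/setD1P=> nexv Sx; rewrite fixr // (negPf nexv).
Qed.

(** Vertices of [A] may still fold; the attached cycles take care of them. *)
Definition rel_stiff (B : graph) (A S : {set B}) : Prop :=
  forall v w, v \in S -> v \notin A -> w \in S ->
    {in S, forall z, edge v z -> edge w z} -> w = v.

Lemma rel_stiff_of_no_rel_fold (B : graph) (A S : {set B}) :
  A \subset S -> (forall T, ~~ rel_fold A S T) -> rel_stiff A S.
Proof.
move=> sAS nofold v w Sv Av Sw sub_vw; apply/eqP/negPn/negP => newv.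
case/negP: (nofold (S :\ v)); apply/existsP; exists (exist _ v Sv).
apply/existsP; exists (exist _ w Sw); rewrite eqxx subsetD1 sAS Av !andbT.
apply/andP; split; first by rewrite -val_eqE.
by apply/subsetP=> -[z Sz]; rewrite !inE; apply: sub_vw.
Qed.

Lemma rel_stiff_retract (B : graph) (A : {set B}) :
  exists (S : {set B}) (r : hom B B),
    [/\ A \subset S, retraction_onto S r, rel_stiff A S
      & exists s, path (rel_fold A) [set: B] s /\ last [set: B] s = S].
Proof.
(* Each fold removes a vertex, so induction on a bound for [#|S|] works, carrying the retraction and
   the folds made so far. *)
suff from n (S : {set B}) (r : hom B B) (s : seq {set B}) :
    #|S| <= n -> A \subset S -> retraction_onto S r ->
    path (rel_fold A) [set: B] s -> last [set: B] s = S ->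
  exists (S : {set B}) (r : hom B B),
    [/\ A \subset S, retraction_onto S r, rel_stiff A S
      & exists s, path (rel_fold A) [set: B] s /\ last [set: B] s = S].
  by apply: (from _ [set: B] (hom_id B) [::] (leqnn _)) => //; exact: subsetT.
elim: n S r s => [|n IHn] S r s leSn sAS rS path_s last_s;
  have [/existsP[T foldT]|/existsPn nofold] := boolP [exists T, rel_fold A S T];
  try (exists S, r; split; [done | done | exact: rel_stiff_of_no_rel_fold |
       by exists s]).
  case/existsP: (foldT) => -[v Sv] _; move: leSn.
  by rewrite leqn0 cards_eq0 => /eqP S0; rewrite S0 inE in Sv.
have [r' r'T] := rel_fold_retraction foldT rS.
have [leTn sAT] : #|T| <= n /\ A \subset T.
  case/existsP: (foldT) => -[v Sv] /existsP[v' /and3P[_ /eqP-> sA]].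
  by split=> //; move: leSn; rewrite (cardsD1 v) Sv.
apply: (IHn T r' (rcons s T)) => //; last by rewrite last_rcons.
by rewrite rcons_path path_s last_s.
Qed.

Section Cycles.

Variables (X : graph) (I : finType) (h : I -> X).

(* The 5-cycle attached at [h a] consists of [inl (h a)] and of [inr (a, 0)],
   ..., [inr (a, 3)] in this order. *)
Definition cycles_edge : rel (X + I * 'I_4)%type :=
  fun p q => match p, q with
  | inl x, inl y => edge x y
  | inl x, inr (a, t) => (x == h a) && ((t == 0 :> nat) || (t == 3 :> nat))
  | inr (a, t), inl x => (x == h a) && ((t == 0 :> nat) || (t == 3 :> nat))
  | inr (a, s), inr (b, t) => (a == b) && ((s.+1 == t) || (t.+1 == s))
  end.

Lemma cycles_edge_sym : symmetric cycles_edge.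
Proof.
move=> [x|[a s]] [y|[b t]] //=; first exact: edge_sym.
by rewrite eq_sym orbC.
Qed.

Definition cycles : graph := Graph cycles_edge_sym.

End Cycles.

Lemma cycles_map_edge (X Y : graph) (I : finType) (h : I -> X) (k : I -> Y)
    (f : hom X Y) (fh : f \o h =1 k) (p q : cycles h) :
  edge p q ->
  edge (match p with inl x => inl (f x) | inr c => inr c end : cycles k)
       (match q with inl x => inl (f x) | inr c => inr c end : cycles k).
Proof.
case: p q => [x|[a s]] [y|[b t]] //=; first exact: hom_edge.
- by case/andP=> /eqP-> ->; rewrite -fh eqxx.
- by case/andP=> /eqP-> ->; rewrite -fh eqxx.
Qed.

(** Attaching cycles is functorial. This gives both the map from [C] to the pushout and the
    extension of [r] to the pushout. *)
Definition cycles_map (X Y : graph) (I : finType) (h : I -> X) (k : I -> Y)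
    (f : hom X Y) (fh : f \o h =1 k) : hom (cycles h) (cycles k) :=
  Hom (cycles_map_edge fh).

Definition cycles_in (X : graph) (I : finType) (h : I -> X) : hom X (cycles h) :=
  @Hom X (cycles h) inl (fun x y xy => xy).

(** Every edge of [cycles i] comes from [B] or from [cycles id], so compatible maps glue. *)
Lemma cycles_pushout (A B : graph) (i : hom A B) :
  is_pushout i (cycles_in id) (cycles_in i)
    (@cycles_map A B A id i i (fun a => erefl (i a))).
Proof.
split=> // H p q pq.
pose u (x : cycles i) : H := match x with inl b => p b | inr c => q (inr c) end.
have pqE a : p (i a) = q (inl a) by exact: pq.
have u_edge x y : edge x y -> edge (u x) (u y).
  case: x y => [x|[a s]] [y|[b t]] /=.
  - exact: hom_edge.
  - case/andP=> /eqP-> bt; rewrite pqE; apply: (hom_edge q).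
    by rewrite /= eqxx bt.
  - case/andP=> /eqP-> at_; rewrite pqE; apply: (hom_edge q).
    by rewrite /= eqxx at_.
  - by move=> e; apply: (hom_edge q).
exists (Hom u_edge); split=> //=.
- by case=> [a|c] //=; rewrite pqE.
- by move=> u' u'p u'q [b|c] /=; [exact: u'p | exact: (u'q (inr c))].
Qed.

Section Stiff.

Variables (A B : graph) (i : hom A B) (S : {set B}) (r : hom B B).
Hypotheses (sAS : [set i a | a : A] \subset S) (rS : retraction_onto S r).
Hypothesis stiffS : rel_stiff [set i a | a : A] S.

Let Si a : i a \in S.
Proof. exact/(subsetP sAS)/imset_f. Qed.

(* If every neighbour of [v] in [S] is [i a], then [v] and [i a] span a
   component of [S], which no homotopy can move. *)
Lemma stiff_nbhd_not_single v a :
    homotopy_equivalence i -> v \in S -> v \notin [set i a | a : A] ->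
  ~ {in S, forall z, edge v z -> z = i a}.
Proof.
move=> [h [_ hi]] Sv Av nbv; have [rB fixr] := rS.
have neav : i a != v by apply: contraNneq Av => <-; exact: imset_f.
(* Otherwise [v] has no neighbour in [S] and folds to [i a] vacuously. *)
have va : edge v (i a).
  apply: contraNT neav => nva; apply/eqP/stiffS => // z Sz vz.
  by rewrite -(nbv z Sz vz) vz in nva.
(* Any neighbour [z] of [i a] in [S] is adjacent to the only neighbour of [v], so [v] would fold to
   [z]. *)
have nba z : z \in S -> edge (i a) z -> z = v.
  by move=> Sz az; apply: stiffS => // y Sy /(nbv y Sy)->; rewrite edge_sym.
have Tv : v \in [set v; i a] by rewrite !inE eqxx.
have Ta : i a \in [set v; i a] by rewrite !inE eqxx orbT.
have rigid : {in [set v; i a], forall x, r (hom_comp i h x) = x}.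
  apply: homotopic_id_rigid hi _ _ => x.
    by case/set2P=> ->; rewrite fixr.
  case/set2P=> -> y sub.
  - by apply: nba => //; rewrite edge_sym; apply: sub.
  - by apply: nbv => //; rewrite edge_sym; apply: sub => //; rewrite edge_sym.
have := rigid v Tv; rewrite fixr //= => defv.
by rewrite -defv imset_f in Av.
Qed.

(** On a 5-cycle, the two neighbours of a vertex have no other common neighbour. This settles [x] in
    the image of [A] or on a cycle; elsewhere stiffness of [S] applies. *)
Lemma cycles_stiff (x y : cycles i) :
    homotopy_equivalence i ->
    let T := [set p : cycles i | if p is inl b then b \in S else true] in
    x \in T -> y \in T -> {in T, forall z, edge x z -> edge y z} -> y = x.
Proof.
move=> hequiv T; rewrite !inE => Tx Ty sub.
have Tinr a t : inr (a, t) \in T by rewrite inE.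
have Tinl b : (inl b \in T) = (b \in S) by rewrite inE.
case: x Tx sub => [v Sv|[a t] _] sub.
  have [/imsetP[a _ defv]|Av] := boolP (v \in [set i a | a : A]).
    have y_adj (s : 'I_4) : (s == 0 :> nat) || (s == 3 :> nat) -> edge y (inr (a, s)).
      by move=> s03; apply: sub; rewrite //= defv eqxx.
    have {sub y_adj} := (y_adj (@Ordinal 4 0 isT) isT, y_adj (@Ordinal 4 3 isT) isT).
    case: y Ty => [b|[b s]] _ /= [] /andP[/eqP eb]; first by rewrite eb defv.
    by move=> s0 /andP[_]; move: s0; case: s => -[|[|[|[|]]]].
  case: y Ty sub => [w Sw|[a s] _] sub.
    congr inl; apply: (stiffS Sv Av Sw) => z Sz vz.
    by apply: (sub (inl z)); rewrite ?Tinl.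
  (* A cycle vertex [y] has at most the neighbour [i a] in [S], so [v] would have no other. *)
  case: (@stiff_nbhd_not_single v a hequiv Sv Av) => z Sz vz.
  have /(_ _ vz) := sub (inl z); rewrite Tinl => /(_ Sz) /=.
  by case/andP=> /eqP.
have y_adj (s : 'I_4) : (t.+1 == s) || (s.+1 == t) -> edge y (inr (a, s)).
  by move=> st; apply: sub; rewrite //= eqxx.
have y_adja : (t == 0 :> nat) || (t == 3 :> nat) -> edge y (inl (i a)).
  by move=> t03; apply: sub; rewrite ?Tinl //= eqxx.
suff [b [s [-> [-> st]]]] : exists b (s : 'I_4), y = inr (b, s) /\ b = a /\ s = t :> nat.
  by congr (inr (_, _)); exact: val_inj.
move: {Ty sub} y_adj y_adja; case: t => -[|[|[|[|t]]]] //= _ y_adj y_adja;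
  [ have := (y_adj (@Ordinal 4 1 isT) isT, y_adja isT)
  | have := (y_adj (@Ordinal 4 0 isT) isT, y_adj (@Ordinal 4 2 isT) isT)
  | have := (y_adj (@Ordinal 4 1 isT) isT, y_adj (@Ordinal 4 3 isT) isT)
  | have := (y_adj (@Ordinal 4 2 isT) isT, y_adja isT) ];
  case: y {y_adj y_adja} => [b|[b s]] /=; rewrite ?andbF; try by case.
all: case=> /andP[/eqP-> s1] /andP[_ s2]; exists a, s; do 2!split=> //.
all: by move: s1 s2; case: s => -[|[|[|[|]]]].
Qed.

End Stiff.

Theorem proposition3p6 (A B : graph) (i : hom A B)
  (hi : induced_inclusion i)
  (hequiv : homotopy_equivalence i)
  (hcard : #|A| < #|B|)
  (hfold : ~ folds_to [set i a | a : A]) :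
  exists (C : graph) (f : hom A C) (G : graph) (j : hom C G),
    is_cobase_change i f j /\ ~ homotopy_equivalence j.
Proof.
have [S [r [sAS rS stiffS [s [path_s last_s]]]]] :=
  rel_stiff_retract [set i a | a : A].
have [rB fixr] := rS.
have /subsetPn[v Sv Av] : ~~ (S \subset [set i a | a : A]).
  apply/negP=> sSA; apply: hfold; exists s; split=> //; rewrite last_s.
  by apply/eqP; rewrite eqEsubset sSA.
have ri : r \o i =1 i by move=> a; apply/fixr/(subsetP sAS)/imset_f.
set j := @cycles_map A B A id i i (fun a => erefl (i a)).
exists (cycles id), (cycles_in id), (cycles i), j; split.
  by exists (cycles_in i); apply: cycles_pushout.
case=> g [_ jg]; pose R := cycles_map ri.
pose T := [set p : cycles i | if p is inl b then b \in S else true].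
have rigid : {in T, forall x, R (hom_comp j g x) = x}.
  apply: homotopic_id_rigid jg _ _ => x.
    by rewrite inE; case: x => //= b Sb; rewrite fixr.
  move=> Tx y; apply: (cycles_stiff sAS rS stiffS hequiv Tx).
  by rewrite inE; case: y => //= b; apply: rB.
(* The map [R] after [j] keeps cycle vertices on the cycles and sends [inl a] to [inl (i a)], so it
   cannot reach [inl v]. *)
have /rigid : inl v \in T by rewrite inE.
rewrite /=; case: (g (inl v)) => //= a [defv].
by rewrite -defv [r _]ri imset_f in Av.
Qed.
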